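(* There exist absolute constants $C_2,C_3>0$ and, for every $d\in\mathbb{N}$, a constant $C_1(d)>0$ such that for every $n\in\mathbb{N}$ and every nonempty $Q\subset\mathbb{Z}^d\cap[-2^n,2^n]^d$ there exists a set of $m\le C_1(d)|Q|n^{7/2}$ points $\xi^j\in\mathbb{T}^d$, $j=1,\dots,m$, such that for every $f\in\mathcal{T}(Q)$ $$C_2\|f\|_1\le\frac1m\sum_{j=1}^m|f(\xi^j)|\le C_3\|f\|_1.$$
   Context: $\mathbb{T}^d=[0,2\pi)^d$ is the torus with normalized Lebesgue measure $(2\pi)^{-d}d\mathbf{x}$, and $\|\cdot\|_1$ is the corresponding $L_1$ norm. $\mathbb{N}=\{1,2,\dots\}$. For finite $Q\subset\mathbb{Z}^d$, $\mathcal{T}(Q)$ is the complex linear space of trigonometric polynomials $f(\mathbf{x})=\sum_{\mathbf{k}\in Q}c_{\mathbf{k}}e^{i(\mathbf{k},\mathbf{x})}$. The number of points $m$ is at least $1$. *)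

(* Defs.v *)
From HB Require Import structures.
From mathcomp Require Import all_boot all_order all_algebra.
From mathcomp Require Import finmap complex.
From mathcomp Require Import all_classical all_reals all_analysis.

Set Implicit Arguments.
Unset Strict Implicit.
Unset Printing Implicit Defensive.

Import Order.TTheory GRing.Theory Num.Theory.
Import numFieldNormedType.Exports.

Local Open Scope classical_set_scope.
Local Open Scope ring_scope.

Section lebesgue_measure_on_tuples.
Context {R : realType}.

(* The domain is the type on which the library's [lebesgue_measure] lives; its
   measurable sets are those of R. *)
Definition consT d (p : measurableTypeR R * d.-tuple R) : d.+1.-tuple R :=
  [tuple of p.1 :: p.2].

Definition unconsT d (t : d.+1.-tuple R) : measurableTypeR R * d.-tuple R :=
  (thead t, [tuple of behead t]).

Lemma consTK d : cancel (@consT d) (@unconsT d).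
Proof. by case=> x t; congr pair; apply/val_inj. Qed.

Lemma measurable_consT d : measurable_fun setT (@consT d).
Proof.
apply: (measurable_cons (T2 := R) (f := fst) (g := snd)).
- exact: (@measurable_fst _ _ (measurableTypeR R)).
- exact: measurable_snd.
Qed.

Lemma measurable_unconsT d : measurable_fun setT (@unconsT d).
Proof.
apply/measurable_fun_pairP; split.
- exact: (measurable_tnth (T := R) ord0).
- exact: measurable_behead.
Qed.

Section step.
Variables (d : nat) (mu : {sigma_finite_measure set (d.-tuple R) -> \bar R}).

Definition lebesgue_tupleS : set (d.+1.-tuple R) -> \bar R :=
  pushforward (lebesgue_measure \x mu)%E (@consT d).

Let lebesgue_tupleS0 : lebesgue_tupleS set0 = 0%E.
Proof. by rewrite /lebesgue_tupleS /pushforward preimage_set0 measure0. Qed.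

Let lebesgue_tupleS_ge0 A : (0 <= lebesgue_tupleS A)%E.
Proof. exact: (measure_ge0 (lebesgue_measure \x mu)%E). Qed.

Let lebesgue_tupleS_sigma_additive : semi_sigma_additive lebesgue_tupleS.
Proof.
have mpre (A : set (d.+1.-tuple R)) : measurable A -> measurable (@consT d @^-1` A).
  by move=> mA; rewrite -[X in measurable X]setTI; exact: measurable_consT.
move=> F mF tF mUF; rewrite /lebesgue_tupleS /pushforward preimage_bigcup.
apply: measure_semi_sigma_additive.
- by move=> n; exact: mpre.
- apply/trivIsetP => /= i j _ _ ij; rewrite -preimage_setI.
  by move/trivIsetP : tF => /(_ _ _ _ _ ij) ->//; rewrite preimage_set0.
- by rewrite -preimage_bigcup; exact: mpre.
Qed.

HB.instance Definition _ := isMeasure.Build _ _ _ lebesgue_tupleS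
  lebesgue_tupleS0 lebesgue_tupleS_ge0 lebesgue_tupleS_sigma_additive.

Let lebesgue_tupleS_sigma_finite : sigma_finite setT lebesgue_tupleS.
Proof.
have /sigma_finiteP[F [TF ndF Foo]] := sigma_finiteT (@lebesgue_measure R).
have /sigma_finiteP[G [TG ndG Goo]] := sigma_finiteT mu.
exists (fun n => @unconsT d @^-1` (F n `*` G n)).
  rewrite -preimage_bigcup (_ : \bigcup_n _ = setT) ?preimage_setT//.
  rewrite -setXTT TF TG predeqE => -[x y]; split; last first.
    by move=> [/= [n _ Fx] [k _ Gy]]; exists (maxn n k) => //; split;
      [move: x Fx; exact/subsetPset/ndF/leq_maxl
      |move: y Gy; exact/subsetPset/ndG/leq_maxr].
  by move=> [n _ []/= ? ?]; split; exists n.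
move=> k; have [mF Fk] := Foo k; have [mG Gk] := Goo k; split.
  rewrite -[X in measurable X]setTI.
  by apply: measurable_unconsT => //; exact: measurableX.
rewrite /lebesgue_tupleS /pushforward -comp_preimage.
rewrite (_ : _ \o _ = id); last by apply/funext => p /=; rewrite consTK.
by rewrite preimage_id product_measure1E// lte_mul_pinfty// ge0_fin_numE.
Qed.

HB.instance Definition _ := Measure_isSigmaFinite.Build _ _ _
  lebesgue_tupleS lebesgue_tupleS_sigma_finite.

End step.

(* The d-dimensional Lebesgue measure, as an iterated product measure. *)
Fixpoint lebesgue_tuple d : {sigma_finite_measure set (d.-tuple R) -> \bar R} :=
  if d is d'.+1 then lebesgue_tupleS (lebesgue_tuple d') else \d_[tuple].

End lebesgue_measure_on_tuples.

Arguments lebesgue_tuple : clear implicits.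

Section trigonometric_polynomials.
Context {R : realType}.

Definition torus d : set (d.-tuple R) :=
  [set x | forall i, 0 <= tnth x i < 2 * pi].
Arguments torus : clear implicits.

Definition dotp d (k : d.-tuple int) (x : d.-tuple R) : R :=
  \sum_(i < d) (tnth k i)%:~R * tnth x i.

Definition expi (t : R) : R[i] := (cos t +i* sin t)%C.

Definition trigpoly d (Q : {fset d.-tuple int}) : set (d.-tuple R -> R[i]) :=
  [set f | exists c : d.-tuple int -> R[i],
     f = fun x => \sum_(k <- Q) c k * expi (dotp k x)].

(* The real-valued modulus; the library's norm on R[i] takes values in R[i]. *)
Definition cabs (z : R[i]) : R := ComplexField.Normc.normc z.

Definition norm1 d (f : d.-tuple R -> R[i]) : R :=
  (2 * pi) ^- d * \int[lebesgue_tuple R d]_(x in torus d) cabs (f x).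

End trigonometric_polynomials.

Arguments torus : clear implicits.

(* Main.v *)
Require Import Defs.
From mathcomp Require Import all_boot all_order all_algebra.
From mathcomp Require Import finmap complex.
From mathcomp Require Import all_classical all_reals all_analysis.
From mathcomp Require Import measurable_realfun lra ring zify.

(** Write [N] for the cardinality of [Q] and [G] for the grid of step
[2 pi / M] in the torus, with [M] a power of two of size [2 ^ O(n d)]. By
discrete orthogonality the characters of [Q] are orthogonal on [G], so [f] on
[G] is the mean over [x] in [G] of [f x] times the Dirichlet kernel of [Q]
centred at [x]. Hence the real and imaginary parts of [f] are combinations of
[2 |G|] fixed functions, bounded by [N] and with mean square at most [N], with
coefficients of total mass at most twice the discrete [L_1] norm of [f].

For such an absolutely convex hull, [G] can be thinned by repeated halving with
random signs. At each step the contraction principle replaces [|u|] by [u];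
the supremum of a linear functional over the hull is its maximum over the
generators; and a sub-Gaussian union bound controls that maximum. When each
remaining point carries mass [w], the step costs [O(sqrt (w N log |G|))].
These costs grow geometrically, so the halving can go on until [O(N log |G|)],
that is [O(d^2 n N)], points are left.

Finally, Fourier coefficients are bounded by the discrete [L_1] norm, so [f] is
Lipschitz with a constant which the fineness of the grid beats, and the discrete
and continuous [L_1] norms are comparable. *)

Import Order.TTheory GRing.Theory Num.Theory.
Import numFieldNormedType.Exports.
Local Open Scope classical_set_scope.
Local Open Scope ring_scope.

Set Implicit Arguments.
Unset Strict Implicit.
Unset Printing Implicit Defensive.

(** * Random signs *)

Section rademacher.
Context {R : realType} {G : finType}.
Implicit Types (e : {ffun G -> bool}) (v : G -> R).

Definition rademacher e v : R := \sum_j (-1) ^+ e j * v j.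

(** Up to [1/2], [expR x * (1 - x) <= 1] yields [expR x <= 1 + x + 2 * x ^+ 2], and likewise for
    [- x]; beyond, [x <= 2 * x ^+ 2] suffices. The constant 2 instead of the sharp [1/2] keeps the
    proof elementary. *)
Lemma cosh_le_expR (x : R) : expR x + expR (- x) <= 2 * expR (2 * x ^+ 2).
Proof.
wlog x0 : x / 0 <= x => [th|].
  have [/th//|/ltW x0] := leP 0 x.
  by have := th (- x); rewrite opprK sqrrN addrC oppr_ge0; apply.
have [xh|xh] := leP x (2^-1).
  have e1 : 1 + 2 * x ^+ 2 <= expR (2 * x ^+ 2) by exact: expR_ge1Dx.
  have e2 : expR x * (1 - x) <= 1.
    rewrite -[leRHS](expRxMexpNx_1 x) ler_pM2l ?expR_gt0//.
    exact: (expR_ge1Dx (- x)).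
  have e3 : expR (- x) * (1 + x) <= 1.
    rewrite -[leRHS](expRxMexpNx_1 x) mulrC ler_pM2r ?expR_gt0//.
    exact: (expR_ge1Dx x).
  have e4 : expR x <= 1 + x + 2 * x ^+ 2.
    suff : (1 - x) * (1 + x + 2 * x ^+ 2 - expR x) >= 0 by rewrite pmulr_rge0; lra.
    have : 0 <= x ^+ 2 * (1 - 2 * x) by rewrite mulr_ge0 ?sqr_ge0; lra.
    by nra.
  have e5 : expR (- x) <= 1 - x + 2 * x ^+ 2.
    suff : (1 + x) * (1 - x + 2 * x ^+ 2 - expR (- x)) >= 0 by rewrite pmulr_rge0; lra.
    have : 0 <= x ^+ 2 * (1 + 2 * x) by rewrite mulr_ge0 ?sqr_ge0; lra.
    by nra.
  by lra.
have : expR x <= expR (2 * x ^+ 2) by rewrite ler_expR; nra.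
have : expR (- x) <= expR x by rewrite ler_expR; lra.
by lra.
Qed.

(** The sum over all sign vectors factors over the coordinates, each factor being twice a hyperbolic
    cosine. *)
Lemma sum_rademacher_mgf v :
  \sum_e expR (rademacher e v) <= 2 ^+ #|G| * expR (2 * \sum_j v j ^+ 2).
Proof.
have -> : \sum_e expR (rademacher e v) = \prod_j (expR (v j) + expR (- v j)).
  transitivity (\prod_j \sum_(b : bool) expR ((-1) ^+ b * v j)).
    rewrite bigA_distr_bigA/=; apply: eq_bigr => e _.
    by rewrite expR_sum.
  by apply: eq_bigr => j _; rewrite big_bool/= expr1 mulN1r expr0 mul1r addrC.
rewrite mulr_sumr expR_sum -prodr_const -big_split/=.
apply: ler_prod => j _; rewrite cosh_le_expR andbT.
by rewrite addr_ge0 ?expR_ge0.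
Qed.

Lemma rademacherZ a e v : rademacher e (fun j => a * v j) = a * rademacher e v.
Proof. by rewrite mulr_sumr; apply: eq_bigr => j _; rewrite mulrCA. Qed.

(** Sub-Gaussian maximal inequality: a sum of exponentials dominates the maximum of the [2 * #|I|]
    signed sums, and [L] bounds the logarithm of their number. The parameter [l] stays free, to be
    balanced against [s] later. *)
Lemma rademacher_max (I : finType) (u : I -> G -> R) (L l s : R) :
  (0 < #|I|)%N -> 0 < l -> 2 * #|I|%:R <= expR L ->
  (forall i, \sum_j u i j ^+ 2 <= s) ->
  exists2 B : {ffun G -> bool} -> R,
    forall e i, `|rademacher e (u i)| <= B e &
    \sum_e B e <= 2 ^+ #|G| * (L / l + 2 * l * s).
Proof.
move=> I0 l0 LI us; pose a := L + 2 * l ^+ 2 * s.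
pose Y e := \sum_i (expR (l * rademacher e (u i)) + expR (- (l * rademacher e (u i)))).
(* Jensen's inequality for [ln] enters only through [y <= a - 1 + expR (y - a)]. *)
exists (fun e => l^-1 * (a - 1 + expR (- a) * Y e)).
  move=> e i; rewrite -[leLHS](mulKf (lt0r_neq0 l0)) ler_pM2l ?invr_gt0//.
  have ha : expR (l * `|rademacher e (u i)|) <= Y e.
    rewrite /Y (bigD1 i)//=.
    apply: (@le_trans _ _ (expR (l * rademacher e (u i)) + expR (- (l * rademacher e (u i))))).
      have [r0|r0] := leP 0 (rademacher e (u i)).
        by rewrite ger0_norm// lerDl expR_ge0.
      by rewrite ltr0_norm// mulrN lerDr expR_ge0.
    by rewrite lerDl sumr_ge0// => k _; rewrite addr_ge0 ?expR_ge0.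
  have : expR (l * `|rademacher e (u i)| - a) <= expR (- a) * Y e.
    by rewrite addrC expRD ler_pM2l ?expR_gt0.
  have := expR_ge1Dx (l * `|rademacher e (u i)| - a).
  by lra.
have YE : \sum_e Y e <= 2 ^+ #|G| * expR a.
  rewrite /Y exchange_big/=.
  apply: (@le_trans _ _ (\sum_(i : I) 2 * (2 ^+ #|G| * expR (2 * l ^+ 2 * s)))).
    apply: ler_sum => i _; rewrite big_split/= mulr_natl mulr2n.
    have h (b : R) : b ^+ 2 = l ^+ 2 ->
        \sum_e expR (b * rademacher e (u i)) <= 2 ^+ #|G| * expR (2 * l ^+ 2 * s).
      move=> bl; under eq_bigr do rewrite -rademacherZ.
      apply: le_trans (sum_rademacher_mgf _) _.
      rewrite ler_pM2l ?exprn_gt0// ler_expR.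
      under eq_bigr do rewrite exprMn bl.
      by rewrite -mulr_sumr mulrA ler_pM2l ?us// mulr_gt0 ?exprn_gt0.
    apply: lerD; first exact: h.
    by under eq_bigr do rewrite -mulNr; apply: h; rewrite sqrrN.
  rewrite sumr_const -[leLHS]mulr_natr /a expRD.
  apply: (@le_trans _ _ (2 ^+ #|G| * (2 * #|I|%:R * expR (2 * l ^+ 2 * s)))).
    rewrite le_eqVlt; apply/orP; left; apply/eqP. ring.
  by rewrite ler_pM2l ?exprn_gt0// ler_pM2r ?expR_gt0.
rewrite -mulr_sumr big_split/= sumr_const -mulr_sumr card_ffun card_bool.
rewrite -[(a - 1) *+ _]mulr_natr natrX.
have -> : L / l + 2 * l * s = l^-1 * a.
  by rewrite /a; field; rewrite lt0r_neq0.
rewrite mulrCA ler_pM2l ?invr_gt0//.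
have : expR (- a) * (\sum_e Y e) <= 2 ^+ #|G|.
  apply: (@le_trans _ _ (expR (- a) * (2 ^+ #|G| * expR a))).
    by rewrite ler_pM2l ?expR_gt0.
  by rewrite mulrCA [expR (- a) * _]mulrC expRxMexpNx_1 mulr1.
by lra.
Qed.

End rademacher.

Section contraction.
Context {R : realType} {G : finType}.

Lemma rademacher_le (e : {ffun G -> bool}) (v : G -> R) (K : R) :
  (forall j, `|v j| <= K) -> rademacher e v <= #|G|%:R * K.
Proof.
move=> vK; rewrite -sum1_card natr_sum mulr_suml; apply: ler_sum => j _.
rewrite mul1r; apply: le_trans (vK j).
by rewrite (le_trans (ler_norm _))// normrM normrX normrN1 expr1n mul1r.
Qed.

(* Contraction principle, one coordinate [k] at a time: pairing the two signs of
   [k], the claim reduces to [`|x| - `|y| <= `|x - y|]. *)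
Lemma sum_sup_rademacher_norm (T : Type) (D : set T) (u : T -> G -> R) (K : R) :
  D !=set0 -> (forall t, D t -> forall j, `|u t j| <= K) ->
  \sum_e sup [set rademacher e (fun j => `|u t j|) | t in D] <=
  \sum_e sup [set rademacher e (u t) | t in D].
Proof.
move=> [t0 Dt0] uK.
pose w (s : seq G) t j := if j \in s then `|u t j| else u t j.
pose Z s e := sup [set rademacher e (w s t) | t in D].
have ZP s e t : D t -> rademacher e (w s t) <= Z s e.
  move=> Dt; apply: ub_le_sup; last by exists t.
  exists (#|G|%:R * K) => _ [t' Dt' <-]; apply: rademacher_le => j.
  by rewrite /w; case: ifP; rewrite ?normr_id uK.
suff main s : \sum_e Z s e <= \sum_e Z [::] e.
  have := main (enum G); rewrite /Z /w.
  by under eq_bigr do under eq_fun do under eq_fun do rewrite mem_enum.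
elim: s => [//|k s IH]; apply: le_trans IH.
have [ks|ks] := boolP (k \in s).
  rewrite le_eqVlt; apply/orP; left; apply/eqP; apply: eq_bigr => e _.
  rewrite /Z (_ : w (k :: s) = w s)//; apply/funext => t; apply/funext => j.
  by rewrite /w in_cons; case: eqVneq => [->|//]; rewrite ks.
pose flip (e : {ffun G -> bool}) := [ffun j => if j == k then ~~ e j else e j].
have flipK : involutive flip.
  by move=> e; apply/ffunP => j; rewrite !ffunE; case: eqP => // _; rewrite negbK.
have flip_sum F : \sum_e F (flip e) = \sum_e F e :> R.
  by rewrite [RHS](reindex_inj (inv_inj flipK)).
suff pair e : Z (k :: s) e + Z (k :: s) (flip e) <= Z s e + Z s (flip e).
  have : \sum_e (Z (k :: s) e + Z (k :: s) (flip e)) <=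
    \sum_e (Z s e + Z s (flip e)) by exact: ler_sum.
  by rewrite !big_split/= !flip_sum; lra.
pose h t := \sum_(j | j != k) (-1) ^+ e j * w s t j.
have He a t : rademacher e (w a t) = (-1) ^+ e k * w a t k +
    \sum_(j | j != k) (-1) ^+ e j * w a t j by rewrite /rademacher (bigD1 k).
have Hf a t : rademacher (flip e) (w a t) = - ((-1) ^+ e k * w a t k) +
    \sum_(j | j != k) (-1) ^+ e j * w a t j.
  rewrite /rademacher (bigD1 k)//= !ffunE eqxx; congr (_ + _).
    by case: (e k); rewrite ?expr0 ?expr1; ring.
  by apply: eq_bigr => j jk; rewrite ffunE (negbTE jk).
have hk t : \sum_(j | j != k) (-1) ^+ e j * w (k :: s) t j = h t.
  by apply: eq_bigr => j jk; rewrite /w in_cons (negbTE jk).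
have wk t : w (k :: s) t k = `|u t k| by rewrite /w mem_head.
have wk' t : w s t k = u t k by rewrite /w (negbTE ks).
have key t t' : D t -> D t' -> rademacher e (w (k :: s) t) +
    rademacher (flip e) (w (k :: s) t') <= Z s e + Z s (flip e).
  move=> Dt Dt'; rewrite He Hf !hk !wk.
  have := ZP s e t Dt; have := ZP s e t' Dt'.
  have := ZP s (flip e) t Dt; have := ZP s (flip e) t' Dt'.
  rewrite !He !Hf !wk' -/(h t) -/(h t').
  have /ler_normlP[] := ler_dist_dist (u t k) (u t' k).
  (* This sign and [e k] decide which of [t], [t'] is tested against [Z s e] and which against
     [Z s (flip e)]. *)
  have [x0|x0] := leP 0 (u t k - u t' k).
    by rewrite (ger0_norm x0); case: (e k); rewrite ?expr0 ?expr1; lra.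
  by rewrite (ltr0_norm x0); case: (e k); rewrite ?expr0 ?expr1; lra.
have Zle e' c : (forall t, D t -> rademacher e' (w (k :: s) t) <= c) ->
    Z (k :: s) e' <= c.
  move=> ub; rewrite /Z; apply: ge_sup => [|_ [t Dt <-]]; last exact: ub.
  by exists (rademacher e' (w (k :: s) t0)), t0.
rewrite -lerBrDr; apply: (Zle) => t Dt; rewrite lerBrDr addrC -lerBrDr.
by apply: Zle => t' Dt'; rewrite lerBrDr addrC key.
Qed.

End contraction.

Lemma exists_le_mean {R : realType} {T : finType} (f : T -> R) (c : R) :
  (0 < #|T|)%N -> \sum_t f t <= #|T|%:R * c -> exists t, f t <= c.
Proof.
move=> /card_gt0P[t0 _] fc; pose t := [arg min_(i < t0) f i]%O; exists t.
have tmin i : f t <= f i by rewrite /t; case: arg_minP => // j _; exact.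
have T0 : 0 < #|T|%:R :> R by rewrite ltr0n; apply/card_gt0P; exists t0.
rewrite -(ler_pM2l T0); apply: le_trans fc.
by rewrite -sum1_card natr_sum mulr_suml; apply: ler_sum => i _; rewrite mul1r.
Qed.

(** * Sampling in an absolutely convex hull *)

Section hull_sampling.
Context {R : realType} {I G : finType} (kappa : I -> G -> R) (N L : R).
Hypotheses (I0 : (0 < #|I|)%N) (N0 : 0 < N) (L0 : 0 < L).
Hypotheses (IL : 2 * #|I|%:R <= expR L) (kN : forall i j, `|kappa i j| <= N).

Definition lincomb (c : I -> R) (j : G) : R := \sum_i c i * kappa i j.

Lemma norm_lincomb_le c j : \sum_i `|c i| <= 1 -> `|lincomb c j| <= N.
Proof.
move=> c1; apply: (le_trans (ler_norm_sum _ _ _)).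
apply: (@le_trans _ _ (\sum_i `|c i| * N)).
  by apply: ler_sum => i _; rewrite normrM ler_wpM2l.
by rewrite -mulr_suml ler_piMl// ltW.
Qed.

(** Keep the points of [S] whose random sign is [+1]: twice a sum over them is the sum over [S] plus
    a sign sum. Contraction and the maximal inequality control the hull; the second conclusion keeps
    the squares of the generators bounded for the next halving. *)
Lemma halving (S : {set G}) (l s : R) : 0 < l ->
  (forall i, \sum_(j in S) kappa i j ^+ 2 <= s) ->
  exists S' : {set G},
    (forall c, \sum_i `|c i| <= 1 ->
      `|2 * \sum_(j in S') `|lincomb c j| - \sum_(j in S) `|lincomb c j| |
        <= 3 * (L / l + 2 * l * s)) /\
    (forall i, 2 * \sum_(j in S') kappa i j ^+ 2 <=
      \sum_(j in S) kappa i j ^+ 2 + 3 * N * (L / l + 2 * l * s)).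
Proof.
move=> l0 ks; set delta := L / l + 2 * l * s.
pose res (v : G -> R) j := if j \in S then v j else 0.
have sum_res v : \sum_j res v j = \sum_(j in S) v j by rewrite [RHS]big_mkcond.
have [B1 B1P B1s] : exists2 B : {ffun G -> bool} -> R,
    forall e i, `|rademacher e (res (kappa i))| <= B e &
    \sum_e B e <= 2 ^+ #|G| * delta.
  apply: rademacher_max => // i; rewrite (le_trans _ (ks i))//.
  rewrite -sum_res; apply: ler_sum => j _; rewrite /res.
  by case: ifP => // _; rewrite expr0n.
(* Since [|kappa i j| <= N], the square of [kappa i j ^+ 2 / N] is at most [kappa i j ^+ 2], so the
   same [s] serves. *)
have [B2 B2P B2s] : exists2 B : {ffun G -> bool} -> R,
    forall e i, `|rademacher e (res (fun j => kappa i j ^+ 2 / N))| <= B e &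
    \sum_e B e <= 2 ^+ #|G| * delta.
  apply: rademacher_max => // i; rewrite (le_trans _ (ks i))//.
  rewrite -sum_res; apply: ler_sum => j _; rewrite /res.
  case: ifP => // _; last by rewrite expr0n.
  rewrite exprMn -[leRHS]mulr1 expr2 -mulrA ler_wpM2l ?sqr_ge0//.
  rewrite exprVn ler_pdivrMr ?exprn_gt0// mul1r -real_normK ?num_real//.
  by rewrite lerXn2r ?nnegrE// ltW.
pose D : set (I -> R) := [set c | \sum_i `|c i| <= 1].
have D0 : D (fun=> 0) by rewrite /D/= big1 // => i _; rewrite normr0.
pose u c := res (lincomb c).
have uN c : D c -> forall j, `|u c j| <= N.
  move=> Dc j; rewrite /u /res; case: ifP => _; last by rewrite normr0 ltW.
  exact: norm_lincomb_le.
pose Z e := sup [set rademacher e (fun j => `|u c j|) | c in D].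
have ZP e c : D c -> rademacher e (fun j => `|u c j|) <= Z e.
  move=> Dc; apply: ub_le_sup; last by exists c.
  exists (#|G|%:R * N) => _ [t' Dt' <-]; apply: rademacher_le => j.
  by rewrite normr_id uN.
have Zs : \sum_e Z e <= 2 ^+ #|G| * delta.
  apply: le_trans B1s; apply: (@le_trans _ _ (\sum_e sup [set rademacher e (u c) | c in D])).
    by apply: sum_sup_rademacher_norm uN; exists (fun=> 0).
  apply: ler_sum => e _; apply: ge_sup.
    by exists (rademacher e (u (fun=> 0))), (fun=> 0).
  move=> _ [c Dc <-]; have B0 : 0 <= B1 e.
    by move/card_gt0P : I0 => [i _]; apply: le_trans (B1P e i).
  (* Without absolute values the sign sum is linear in [c], so the generators control it on the
     whole hull. *)
  have -> : rademacher e (u c) = \sum_i c i * rademacher e (res (kappa i)).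
    under [RHS]eq_bigr do rewrite mulr_sumr; rewrite exchange_big/=.
    apply: eq_bigr => j _; rewrite /u /res; case: ifP => _; last first.
      by rewrite mulr0 big1// => i _; rewrite !mulr0.
    by rewrite mulr_sumr; apply: eq_bigr => i _; rewrite mulrCA.
  apply: (@le_trans _ _ (\sum_i `|c i| * B1 e)); last first.
    by rewrite -mulr_suml ler_piMl.
  apply: ler_sum => i _; rewrite (le_trans (ler_norm _))// normrM.
  by rewrite ler_wpM2l.
pose neg (e : {ffun G -> bool}) := [ffun j => ~~ e j].
have negK : involutive neg by move=> e; apply/ffunP => j; rewrite !ffunE negbK.
have rneg e v : rademacher (neg e) v = - rademacher e v.
  rewrite -sumrN; apply: eq_bigr => j _; rewrite ffunE.
  by case: (e j); rewrite ?expr0 ?expr1; ring.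
have Z0 e : 0 <= Z e.
  apply: le_trans (ZP e _ D0); rewrite /rademacher big1// => j _.
  rewrite /u /res /lincomb big1 => [|i _]; last by rewrite mul0r.
  by case: ifP; rewrite normr0 mulr0.
(* [Z e] bounds the deviation from above, [Z (neg e)] from below. All three terms are nonnegative
   with mean at most [delta], so one choice of signs bounds each by [3 * delta]. *)
have [e eP] : exists e, Z e + Z (neg e) + B2 e <= 3 * delta.
  apply: exists_le_mean; first by apply/card_gt0P; exists [ffun=> true].
  rewrite card_ffun card_bool natrX !big_split/=.
  have -> : \sum_e Z (neg e) = \sum_e Z e.
    by rewrite [RHS](reindex_inj (inv_inj negK)).
  by lra.
have B20 : 0 <= B2 e.
  by move/card_gt0P : I0 => [i _]; apply: le_trans (B2P e i).
have halve v : 2 * \sum_(j in [set j in S | ~~ e j]) v j =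
    \sum_(j in S) v j + rademacher e (res v).
  rewrite -sum_res -big_split/= mulr_sumr big_mkcond/=; apply: eq_bigr => j _.
  rewrite inE /res; case: (j \in S); case: (e j) => /=;
    by rewrite ?expr0 ?expr1; ring.
exists [set j in S | ~~ e j]; split.
  move=> c Dc; rewrite halve addrAC subrr add0r.
  have -> : rademacher e (res (fun j => `|lincomb c j|)) =
      rademacher e (fun j => `|u c j|).
    apply: eq_bigr => j _; rewrite /u /res; case: ifP => // _.
    by rewrite normr0.
  have := ZP e c Dc; have := ZP (neg e) c Dc; rewrite rneg.
  have := Z0 e; have := Z0 (neg e).
  by rewrite ler_norml; lra.
move=> i; rewrite halve lerD2l.
have -> : res (fun j => kappa i j ^+ 2) =
    (fun j => N * res (fun j => kappa i j ^+ 2 / N) j).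
  apply/funext => j; rewrite /res; case: ifP => _; last by rewrite mulr0.
  by rewrite mulrC divfK// lt0r_neq0.
rewrite rademacherZ -mulrA mulrCA ler_pM2l//.
apply: le_trans (ler_norm _) _; apply: le_trans (B2P e i) _.
have := Z0 e; have := Z0 (neg e).
by lra.
Qed.

(* [w] is the mass carried by each point of [S], and [r ^+ 2 = L * N * w]. A step
   costs [12 * r] and doubles [w]; since [(30 + 12) ^+ 2 <= 2 * 30 ^+ 2], the
   constant 30 absorbs it. *)
Definition density_invariant (S : {set G}) (w r : R) :=
  (forall c, \sum_i `|c i| <= 1 ->
    `|w * \sum_(j in S) `|lincomb c j| - #|G|%:R^-1 * \sum_j `|lincomb c j| |
      <= 30 * r) /\
  (forall i, w * \sum_(j in S) kappa i j ^+ 2 <= N + 30 * N * r).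

Lemma density_invariant_step (S : {set G}) (w r r' : R) :
  0 < w -> 0 < r -> 0 < r' -> r ^+ 2 = L * N * w -> r' ^+ 2 = L * N * (2 * w) ->
  30 * r <= 1 ->
  density_invariant S w r -> exists S', density_invariant S' (2 * w) r'.
Proof.
move=> w0 r0 r'0 rE r'E r1 [Sa Sb].
(* This value of [l] balances the two terms of [L / l + 2 * l * s]. *)
have [||S' [S'a S'b]] := @halving S (r / (2 * N)) (2 * N / w).
- by rewrite divr_gt0// mulr_gt0.
(* [30 * r <= 1] bounds [N + 30 * N * r] by [2 * N]. *)
- move=> i; rewrite ler_pdivlMr// mulrC; apply: le_trans (Sb i) _.
  have : N * (30 * r) <= N * 1 by rewrite ler_pM2l.
  by lra.
have dE : w * (L / (r / (2 * N)) + 2 * (r / (2 * N)) * (2 * N / w)) = 4 * r.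
  have -> : L = r ^+ 2 / (N * w) by rewrite rE; field; rewrite !lt0r_neq0.
  by field; rewrite !lt0r_neq0.
have rr' : 42 * r <= 30 * r'.
  rewrite -(@ler_pXn2r _ 2)// ?nnegrE ?mulr_ge0 ?ltW//.
  by rewrite !exprMn rE r'E; have := mulr_gt0 (mulr_gt0 L0 N0) w0; nra.
exists S'; split.
  move=> c c1; have := Sa _ c1; have := S'a _ c1.
  set A := \sum_(j in S') _; set B := \sum_(j in S) _.
  move: dE; set d := L / _ + _ => dE.
  rewrite -(ler_pM2l w0) -[X in X * `|_|](gtr0_norm w0) -normrM => h1 h2.
  have -> : 2 * w * A - #|G|%:R^-1 * \sum_j `|lincomb c j| =
    w * (2 * A - B) + (w * B - #|G|%:R^-1 * \sum_j `|lincomb c j|) by ring.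
  by apply: le_trans (ler_normD _ _) _; lra.
move=> i; have := Sb i; have := S'b i.
move: dE; set d := L / _ + _ => dE; rewrite -(ler_pM2l w0) => h1 h2.
have h3 : N * (42 * r) <= N * (30 * r') by rewrite ler_pM2l.
have h4 : w * (3 * N * d) = 12 * N * r by rewrite (_ : _ * _ = 3 * N * (w * d)); [rewrite dE; ring|ring].
by nra.
Qed.

(** Start from all of [G], where the first deviation is zero. As the mass doubles, the hypothesis at
    the last step implies the earlier ones; it reads [120 * r <= 1], which leaves a final error
    [30 * r] of at most [1/4]. *)
Lemma density_invariant_iter (t : nat) : (0 < #|G|)%N ->
  (forall i, \sum_j kappa i j ^+ 2 <= #|G|%:R * N) ->
  120 ^+ 2 * (L * N * (2 ^+ t / #|G|%:R)) <= 1 ->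
  exists S, density_invariant S (2 ^+ t / #|G|%:R)
    (Num.sqrt (L * N * (2 ^+ t / #|G|%:R))).
Proof.
move=> G0 kG; have g0 : 0 < #|G|%:R :> R by rewrite ltr0n.
have LN0 := mulr_gt0 L0 N0.
elim: t => [_|t IH].
  exists finset.setT; rewrite expr0 mul1r; split.
    move=> c _; rewrite [X in _ * X - _](eq_bigl xpredT) => [|j]; last by rewrite inE.
    by rewrite subrr normr0 mulr_ge0// sqrtr_ge0.
  move=> i; rewrite [X in _ * X](eq_bigl xpredT) => [|j]; last by rewrite inE.
  rewrite ler_pdivrMl//; apply: le_trans (kG i) _; rewrite ler_pM2l//.
  by rewrite lerDl mulr_ge0 ?sqrtr_ge0// mulr_ge0// ltW.
have wp : 0 < 2 ^+ t / #|G|%:R :> R by rewrite divr_gt0 ?exprn_gt0.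
have -> : 2 ^+ t.+1 / #|G|%:R = 2 * (2 ^+ t / #|G|%:R) :> R by rewrite exprS mulrA.
move=> h; have h' := mulr_gt0 LN0 wp.
have [|S iS] := IH; first by nra.
have h2 : 0 < L * N * (2 * (2 ^+ t / #|G|%:R)) by rewrite mulr_gt0// mulr_gt0.
apply: density_invariant_step iS => //; rewrite ?sqrtr_gt0//.
- by rewrite sqr_sqrtr// ltW.
- by rewrite sqr_sqrtr// ltW.
- rewrite -(@ler_pXn2r _ 2)// ?nnegrE ?mulr_ge0 ?sqrtr_ge0//.
  rewrite exprMn sqr_sqrtr ?expr1n; first by nra.
  exact: ltW.
Qed.

(** Halve as long as [120 * r <= 1]. The first failure, one doubling later, bounds [w^-1] from
    above; that bound later controls the number of points. *)
Lemma hull_sampling : (0 < #|G|)%N ->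
  (forall i, \sum_j kappa i j ^+ 2 <= #|G|%:R * N) ->
  exists (S : {set G}) (w : R), [/\ 0 < w, w^-1 <= (2 * 120 ^+ 2) * (L * N) &
    forall c, `|w * \sum_(j in S) `|lincomb c j| -
                #|G|%:R^-1 * \sum_j `|lincomb c j| | <= 4^-1 * \sum_i `|c i|].
Proof.
move=> G0 kG; have g0 : 0 < #|G|%:R :> R by rewrite ltr0n.
have LN0 := mulr_gt0 L0 N0.
(* If the test fails before any halving, [G] itself is small enough to be the sample. *)
have [big|small] := ltP 1 (120 ^+ 2 * (L * N * (2 ^+ 0 / #|G|%:R))).
  exists finset.setT, #|G|%:R^-1; split; first by rewrite invr_gt0.
    rewrite invrK; move: big; rewrite expr0 mul1r !mulrA ltr_pdivlMr// mul1r; nra.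
  move=> c; rewrite [X in _ * X - _](eq_bigl xpredT) => [|j]; last by rewrite inE.
  by rewrite subrr normr0 mulr_ge0// ?invr_ge0// sumr_ge0.
have [t Pt] : exists t : nat, 1 < 120 ^+ 2 * (L * N * (2 ^+ t / #|G|%:R)).
  set q := 120 ^+ 2 * (L * N / #|G|%:R).
  have q0 : 0 < q by rewrite !(mulr_gt0, invr_gt0).
  exists (Num.bound q^-1).
  rewrite (_ : 120 ^+ 2 * _ = q * 2 ^+ Num.bound q^-1); last by rewrite /q; ring.
  rewrite -ltr_pdivrMl// mulr1.
  have := archi_boundP (ltW (_ : 0 < q^-1)); rewrite invr_gt0 => /(_ q0) h.
  apply: lt_le_trans h _; rewrite -natrX ler_nat.
  by apply: ltnW; exact: ltn_expl.
(* [m.+1] will be the first number of halvings that fails the test; the factor 2 in the bound on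
   [w^-1] is the last doubling. *)
have := ex_minnP (ex_intro (fun t => 1 < 120 ^+ 2 * (L * N * (2 ^+ t / #|G|%:R))) t Pt).
case=> -[|m]; first by rewrite ltNge small.
move=> Pm mmin.
have Pm' : 120 ^+ 2 * (L * N * (2 ^+ m / #|G|%:R)) <= 1.
  by rewrite leNgt; apply/negP => /mmin; rewrite ltnn.
have [S [Sa _]] := density_invariant_iter G0 kG Pm'.
have wp : 0 < 2 ^+ m / #|G|%:R :> R by rewrite divr_gt0 ?exprn_gt0.
exists S, (2 ^+ m / #|G|%:R); split => //.
  move: Pm; have -> : 2 ^+ m.+1 / #|G|%:R = 2 * (2 ^+ m / #|G|%:R) :> R.
    by rewrite exprS mulrA.
  set w := 2 ^+ m / _ => Pm.
  by rewrite -[leLHS]mulr1 ler_pdivrMl// ltW//; nra.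
have r120 : 30 * Num.sqrt (L * N * (2 ^+ m / #|G|%:R)) <= 4^-1.
  rewrite -(@ler_pXn2r _ 2)// ?nnegrE ?mulr_ge0 ?sqrtr_ge0 ?invr_ge0//.
  rewrite exprMn sqr_sqrtr; last by rewrite ltW// mulr_gt0.
  by nra.
(* The invariant concerns mass at most 1; homogeneity in [c] gives the general case, with zero mass
   treated apart. *)
move=> c; have [c0|cn0] := eqVneq (\sum_i `|c i|) 0.
  have cz i : c i = 0.
    by apply/eqP; rewrite -normr_eq0; apply/eqP; exact: (psumr_eq0P _ c0).
  have lz j : `|lincomb c j| = 0.
    by rewrite /lincomb big1 ?normr0// => i _; rewrite cz mul0r.
  rewrite c0 [X in _ * X - _]big1// [X in _ - _ * X]big1//.
  by rewrite !mulr0 subr0 normr0.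
have cp : 0 < \sum_i `|c i| by rewrite lt_def cn0 sumr_ge0.
set a := \sum_i `|c i| in cn0 cp *.
have := Sa (fun i => a^-1 * c i).
have lE j : `|lincomb (fun i => a^-1 * c i) j| = a^-1 * `|lincomb c j|.
  rewrite /lincomb -[X in X * `|_|]gtr0_norm ?invr_gt0// -normrM mulr_sumr.
  by congr `|_|; apply: eq_bigr => i _; rewrite mulrA.
under eq_bigr do rewrite normrM gtr0_norm ?invr_gt0//.
rewrite -mulr_sumr mulVf// => /(_ (lexx _)).
under eq_bigr do rewrite lE.
under [in X in _ - X]eq_bigr do rewrite lE.
rewrite -!mulr_sumr !(mulrCA _ a^-1) -mulrBr normrM gtr0_norm ?invr_gt0//.
by rewrite ler_pdivrMl// => h; apply: le_trans h _; rewrite mulrC ler_pM2r.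
Qed.

End hull_sampling.

(** * Trigonometric polynomials on a grid *)

Section complex_numbers.
Context {R : realType}.
Implicit Types (z : R[i]) (s t : R).

Lemma Re_sum (I : Type) (r : seq I) (P : pred I) (F : I -> R[i]) :
  complex.Re (\sum_(i <- r | P i) F i) = \sum_(i <- r | P i) complex.Re (F i).
Proof. by apply: (big_morph _ _ _) => [[a b] [c d]|]. Qed.

Lemma Im_sum (I : Type) (r : seq I) (P : pred I) (F : I -> R[i]) :
  complex.Im (\sum_(i <- r | P i) F i) = \sum_(i <- r | P i) complex.Im (F i).
Proof. by apply: (big_morph _ _ _) => [[a b] [c d]|]. Qed.

Lemma Re_mulc z1 z2 : complex.Re (z1 * z2) =
  complex.Re z1 * complex.Re z2 - complex.Im z1 * complex.Im z2.
Proof. by case: z1 => a b; case: z2. Qed.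

Lemma Im_mulc z1 z2 : complex.Im (z1 * z2) =
  complex.Re z1 * complex.Im z2 + complex.Im z1 * complex.Re z2.
Proof. by case: z1 => a b; case: z2. Qed.

Lemma cabs_ge0 z : 0 <= cabs z.
Proof. by case: z => a b; exact: sqrtr_ge0. Qed.

Lemma cabsE z : cabs z ^+ 2 = complex.Re z ^+ 2 + complex.Im z ^+ 2.
Proof. by case: z => a b; rewrite sqr_sqrtr// addr_ge0 ?sqr_ge0. Qed.

Lemma cabs_le_normD z : cabs z <= `|complex.Re z| + `|complex.Im z|.
Proof.
rewrite -(@ler_pXn2r _ 2)// ?nnegrE ?cabs_ge0 ?addr_ge0// cabsE.
rewrite -(real_normK (num_real (complex.Re z))).
rewrite -(real_normK (num_real (complex.Im z))).
have := normr_ge0 (complex.Re z); have := normr_ge0 (complex.Im z).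
by nra.
Qed.

Lemma normRe_le_cabs z : `|complex.Re z| <= cabs z.
Proof.
rewrite -(@ler_pXn2r _ 2)// ?nnegrE ?cabs_ge0// cabsE real_normK ?num_real//.
by rewrite lerDl sqr_ge0.
Qed.

Lemma normIm_le_cabs z : `|complex.Im z| <= cabs z.
Proof.
rewrite -(@ler_pXn2r _ 2)// ?nnegrE ?cabs_ge0// cabsE real_normK ?num_real//.
by rewrite lerDr sqr_ge0.
Qed.

Lemma normD_le_cabs z : `|complex.Re z| + `|complex.Im z| <= 2 * cabs z.
Proof. by have := normRe_le_cabs z; have := normIm_le_cabs z; lra. Qed.

Lemma cabsM z1 z2 : cabs (z1 * z2) = cabs z1 * cabs z2.
Proof. exact: ComplexField.Normc.normcM. Qed.

Lemma cabsD z1 z2 : cabs (z1 + z2) <= cabs z1 + cabs z2.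
Proof. by have := @ComplexField.lec_normD R z1 z2 => /andP[_]. Qed.

Lemma cabs_sum (I : Type) (r : seq I) (P : pred I) (F : I -> R[i]) :
  cabs (\sum_(i <- r | P i) F i) <= \sum_(i <- r | P i) cabs (F i).
Proof.
elim/big_rec2: _ => [|i y1 y2 _ h]; first by rewrite /cabs ComplexField.Normc.normc0.
by apply: le_trans (cabsD _ _) _; rewrite lerD2l.
Qed.

Lemma cabs_expi t : cabs (expi t) = 1.
Proof. by rewrite /cabs/= cos2Dsin2 sqrtr1. Qed.

Lemma cabs_real t : cabs t%:C%C = `|t|.
Proof. by rewrite /cabs/= expr0n/= addr0 sqrtr_sqr. Qed.

Lemma expiD s t : expi (s + t) = expi s * expi t.
Proof.
apply/eqP; rewrite eq_complex Re_mulc Im_mulc /= cosD sinD eqxx/=; apply/eqP; ring.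
Qed.

Lemma expi0 : expi (0 : R) = 1.
Proof. by rewrite /expi cos0 sin0. Qed.

Lemma expi_sum (I : Type) (r : seq I) (P : pred I) (F : I -> R) :
  expi (\sum_(i <- r | P i) F i) = \prod_(i <- r | P i) expi (F i).
Proof. exact: (big_morph _ expiD expi0). Qed.

Lemma expi_natM (m : nat) t : expi (m%:R * t) = expi t ^+ m.
Proof.
elim: m => [|m IH]; first by rewrite mul0r expi0.
by rewrite -natr1 mulrDl mul1r expiD IH exprSr.
Qed.

Lemma expi_int_2pi (q : int) : expi (q%:~R * (2 * pi)) = 1 :> R[i].
Proof.
have e2pi : expi (2 * pi) = 1 :> R[i].
  by rewrite mulr_natl /expi cos2pi sin2pi.
case: q => m; first by rewrite expi_natM e2pi expr1n.
have := expi0; rewrite -(subrr (m.+1%:R * (2 * pi))) expiD expi_natM e2pi.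
by rewrite expr1n mul1r NegzE mulrNz mulNr => <-.
Qed.

(** A geometric sum whose ratio has [M]-th power 1. The hypotheses put the angle strictly between
    [- pi] and [pi] and away from 0, so its sine is nonzero and the ratio is not 1. *)
Lemma sum_expi_eq0 (q : int) (M : nat) : q != 0 -> 2 * `|q| < M%:Z ->
  \sum_(a < M) expi (q%:~R * (2 * pi * a%:R / M%:R)) = 0 :> R[i].
Proof.
move=> q0 qM; have M0 : (0 < M)%N by case: M qM => //; rewrite ltNge mulr_ge0.
have Mr : 0 < M%:R :> R by rewrite ltr0n.
pose th : R := q%:~R * (2 * pi) / M%:R.
have -> : \sum_(a < M) expi (q%:~R * (2 * pi * a%:R / M%:R)) =
    \sum_(a < M) expi th ^+ a.
  apply: eq_bigr => a _; rewrite -expi_natM; congr expi.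
  by rewrite /th; field; rewrite lt0r_neq0.
have z1 : expi th != 1.
  apply/eqP => /(congr1 (@complex.Im R))/= sth.
  have qM' : 2 * `|q%:~R| < M%:R :> R.
    by rewrite -intr_norm -(intrM _ 2) -[M%:R]/(M%:Z%:~R) ltr_int.
  have [qp|qn] := leP 0 q.
    have : 0 < sin th.
      have qr : 0 < q%:~R :> R by rewrite ltr0z lt_def q0.
      apply: sin_gt0_pi; rewrite /th; apply/andP; split.
        by rewrite divr_gt0// mulr_gt0// mulr_gt0// pi_gt0.
      rewrite ltr_pdivrMr// mulrA mulrC ltr_pM2l ?pi_gt0//.
      by move: qM'; rewrite gtr0_norm// mulrC.
    by rewrite sth ltxx.
  have : 0 < sin (- th).
    have qr : q%:~R < 0 :> R by rewrite ltrz0.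
    apply: sin_gt0_pi; rewrite /th -!mulNr; apply/andP; split.
      by rewrite divr_gt0// mulr_gt0 ?oppr_gt0// mulr_gt0// pi_gt0.
    rewrite ltr_pdivrMr// mulrA mulrC ltr_pM2l ?pi_gt0//.
    by move: qM'; rewrite ltr0_norm// mulrC.
  by rewrite sinN sth oppr0 ltxx.
have : (expi th - 1) * (\sum_(a < M) expi th ^+ a) = 0.
  rewrite -subrX1 -expi_natM (_ : M%:R * th = q%:~R * (2 * pi)).
    by rewrite expi_int_2pi subrr.
  by rewrite /th; field; rewrite lt0r_neq0.
by move/eqP; rewrite mulf_eq0 subr_eq0 (negbTE z1) => /eqP.
Qed.

End complex_numbers.

Section grid.
Context {R : realType} (d M : nat).
Local Notation G := {ffun 'I_d -> 'I_M}.

Definition grid_point (a : G) : d.-tuple R :=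
  [tuple 2 * pi * (a i)%:R / M%:R | i < d].

Definition grid_mean (g : d.-tuple R -> R) : R :=
  #|{: G}|%:R^-1 * \sum_(a : G) g (grid_point a).

Lemma grid_point_inj : injective grid_point.
Proof.
move=> a b ab; apply/ffunP => i; apply/val_inj.
have M0 : (0 < M)%N := leq_ltn_trans (leq0n _) (ltn_ord (a i)).
have := congr1 (fun t => tnth t i) ab; rewrite !tnth_mktuple.
have nz : M%:R^-1 != 0 :> R by rewrite invr_neq0// pnatr_eq0 -lt0n.
have pz : 2 * pi != 0 :> R by rewrite mulf_neq0// lt0r_neq0// pi_gt0.
by move/(mulIf nz)/(mulfI pz)/eqP; rewrite eqr_nat => /eqP.
Qed.

Lemma grid_point_torus (a : G) : torus R d (grid_point a).
Proof.
move=> i; rewrite tnth_mktuple.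
have M0 : (0 < M)%N := leq_ltn_trans (leq0n _) (ltn_ord (a i)).
rewrite divr_ge0 ?mulr_ge0 ?pi_ge0//= ltr_pdivrMr ?ltr0n//.
by rewrite ltr_pM2l ?mulr_gt0 ?pi_gt0// ltr_nat.
Qed.

(** The sum factors over the coordinates, and one where [k] and [l] differ contributes 0. Frequency
    differences reach [2 * B], whence [4 * B < M]. *)
Lemma sum_grid_expi (k l : d.-tuple int) (B : nat) : (4 * B < M)%N ->
  (forall i, `|tnth k i| <= B%:Z) -> (forall i, `|tnth l i| <= B%:Z) ->
  \sum_(a : G) expi (dotp k (grid_point a) - dotp l (grid_point a)) =
  (if k == l then #|{: G}|%:R else 0) :> R[i].
Proof.
move=> BM kB lB.
have [->|kl] := eqVneq k l.
  under eq_bigr do rewrite subrr expi0.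
  by rewrite sumr_const.
have [i kli] : exists i, tnth k i != tnth l i.
  apply/existsP; apply: contraNT kl => /existsPn h; apply/eqP/eq_from_tnth => i.
  by apply/eqP; have := h i; rewrite negbK.
transitivity (\sum_(a : G) \prod_i
    expi ((tnth k i - tnth l i)%:~R * (2 * pi * (a i)%:R / M%:R)) : R[i]).
  apply: eq_bigr => a _; rewrite -expi_sum -sumrB; congr expi.
  by apply: eq_bigr => j _; rewrite tnth_mktuple intrB mulrBl.
rewrite -(bigA_distr_bigA (fun i (b : 'I_M) =>
  expi ((tnth k i - tnth l i)%:~R * (2 * pi * b%:R / M%:R)))).
rewrite (bigD1 i)//= sum_expi_eq0 ?mul0r ?subr_eq0//.
have := ler_normB (tnth k i) (tnth l i); have := kB i; have := lB i.
have : (4 * B)%:Z < M%:Z by rewrite ltz_nat.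
by rewrite PoszM; lra.
Qed.

Variables (Q : {fset d.-tuple int}) (B : nat).
Hypotheses (BM : (4 * B < M)%N).
Hypothesis QB : forall k, k \in Q -> forall i, `|tnth k i| <= B%:Z.

Definition dirichlet (y x : d.-tuple R) : R[i] :=
  \sum_(k <- Q) expi (dotp k y - dotp k x).

Lemma sum_grid_coef (c : d.-tuple int -> R[i]) k : k \in Q ->
  \sum_(a : G) (\sum_(l <- Q) c l * expi (dotp l (grid_point a))) *
     expi (- dotp k (grid_point a)) = #|{: G}|%:R * c k.
Proof.
move=> kQ; under eq_bigr do rewrite mulr_suml.
rewrite exchange_big/=; under eq_bigr do
  under eq_bigr do rewrite -mulrA -expiD.
under eq_bigr do rewrite -mulr_sumr.
rewrite (bigD1_seq k)//= (sum_grid_expi BM) ?eqxx; try exact: QB.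
rewrite big_seq_cond big1 ?addr0 1?mulrC// => l /andP[lQ lk].
by rewrite (sum_grid_expi BM) ?(negbTE lk) ?mulr0//; exact: QB.
Qed.

(** The reproducing formula: pairing with the kernel recovers each Fourier coefficient and
    resynthesizes [f] at any [y], on the grid or not. *)
Lemma sum_grid_dirichlet (f : d.-tuple R -> R[i]) y : trigpoly Q f ->
  \sum_(a : G) f (grid_point a) * dirichlet y (grid_point a) = #|{: G}|%:R * f y.
Proof.
case=> c ->; under eq_bigr do rewrite mulr_sumr.
rewrite exchange_big/= mulr_sumr big_seq [RHS]big_seq.
apply: eq_bigr => k kQ; rewrite mulrA -(sum_grid_coef c kQ) mulr_suml.
by apply: eq_bigr => a _; rewrite -mulrA -expiD [- _ + _]addrC.
Qed.

(** Fourier inversion with unimodular characters; it will give [f] a Lipschitz constant in terms of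
    its discrete norm. *)
Lemma cabs_coef_le (c : d.-tuple int -> R[i]) k : k \in Q ->
  #|{: G}|%:R * cabs (c k) <=
  \sum_(a : G) cabs (\sum_(l <- Q) c l * expi (dotp l (grid_point a))).
Proof.
move=> kQ; have -> : #|{: G}|%:R * cabs (c k) = cabs (#|{: G}|%:R * c k).
  rewrite cabsM; congr (_ * _).
  rewrite -[X in cabs X](_ : (#|{: G}|%:R : R)%:C%C = _).
    by rewrite cabs_real ger0_norm.
  by rewrite rmorph_nat.
rewrite -(sum_grid_coef c kQ); apply: le_trans (cabs_sum _ _ _) _.
by apply: ler_sum => a _; rewrite cabsM cabs_expi mulr1.
Qed.

Lemma dirichlet_trigpoly x : trigpoly Q (dirichlet^~ x).
Proof.
exists (fun k => expi (- dotp k x)); apply/funext => y.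
by apply: eq_bigr => k _; rewrite -expiD addrC.
Qed.

Lemma cabs_dirichlet_le y x : cabs (dirichlet y x) <= #|` Q|%:R.
Proof.
apply: le_trans (cabs_sum _ _ _) _; under eq_bigr do rewrite cabs_expi.
by rewrite big_const_seq count_predT iter_addr_0.
Qed.

Lemma dirichletC y x :
  dirichlet x y = (complex.Re (dirichlet y x) -i* complex.Im (dirichlet y x))%C.
Proof.
apply/eqP; rewrite eq_complex/= !Re_sum !Im_sum -sumrN.
apply/andP; split; apply/eqP; apply: eq_bigr => k _ /=.
  by rewrite -cosN opprB.
by rewrite -sinN opprB.
Qed.

(** Apply the reproducing formula to the kernel itself at its centre: Hermitian symmetry makes the
    summand a squared modulus, and the value at the centre is the cardinality of [Q]. *)
Lemma sum_grid_sqr_dirichlet x :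
  \sum_(a : G) cabs (dirichlet (grid_point a) x) ^+ 2 = #|{: G}|%:R * #|` Q|%:R.
Proof.
have := sum_grid_dirichlet x (dirichlet_trigpoly x).
move=> /(congr1 (@complex.Re R)); rewrite Re_sum.
have -> : dirichlet x x = #|` Q|%:R.
  rewrite /dirichlet; under eq_bigr do rewrite subrr expi0.
  by rewrite big_const_seq count_predT iter_addr_0.
have -> : #|{: G}|%:R * #|` Q|%:R = ((#|{: G}|%:R * #|` Q|%:R : R)%:C)%C.
  by rewrite rmorphM !rmorph_nat.
move=> /= <-; apply: eq_bigr => a _.
by rewrite (dirichletC (grid_point a) x) Re_mulc cabsE/=; ring.
Qed.

End grid.

(** * Thinning the grid for trigonometric polynomials *)

Section grid_sampling.
Context {R : realType} (d M B : nat) (Q : {fset d.-tuple int}).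
Local Notation G := {ffun 'I_d -> 'I_M}.
Hypotheses (BM : (4 * B < M)%N) (Q0 : Q != fset0).
Hypothesis QB : forall k, k \in Q -> forall i, `|tnth k i| <= B%:Z.
Local Notation "x '@g'" := (@grid_point R d M x) (at level 2).

(* The constant generator controls the cardinality of the sample. *)
Definition kernel_family (i : G + G + 'I_1) (a : G) : R :=
  match i with
  | inl (inl b) => complex.Re (dirichlet Q (a @g) (b @g))
  | inl (inr b) => complex.Im (dirichlet Q (a @g) (b @g))
  | inr _ => 1
  end.

Definition kernel_coef (u v : G -> R) (i : G + G + 'I_1) : R :=
  match i with
  | inl (inl b) => u b / #|{: G}|%:R
  | inl (inr b) => v b / #|{: G}|%:R
  | inr _ => 0
  end.

Lemma sum_norm_kernel_coef u v : \sum_i `|kernel_coef u v i| =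
  #|{: G}|%:R^-1 * \sum_a (`|u a| + `|v a|).
Proof.
rewrite !big_sumType/= big_ord1 normr0 addr0 -big_split/= mulr_sumr.
apply: eq_bigr => a _; rewrite !normrM normfV normr_nat -mulrDl.
by rewrite mulrC.
Qed.

Lemma lincomb_kernel u v a : lincomb kernel_family (kernel_coef u v) a =
  #|{: G}|%:R^-1 * \sum_b (u b * complex.Re (dirichlet Q (a @g) (b @g)) +
                           v b * complex.Im (dirichlet Q (a @g) (b @g))).
Proof.
rewrite /lincomb !big_sumType/= big_ord1 mul0r addr0 -big_split/= mulr_sumr.
by apply: eq_bigr => b _; ring.
Qed.

Let M0 : (0 < M)%N := leq_ltn_trans (leq0n _) BM.

Let G0 : (0 < #|{: G}|)%N.
Proof. by rewrite card_ffun !card_ord expn_gt0 M0. Qed.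

Let g0 : 0 < #|{: G}|%:R :> R.
Proof. by rewrite ltr0n. Qed.

Let N1 : 1 <= #|` Q|%:R :> R.
Proof. by rewrite ler1n cardfs_gt0. Qed.

Lemma reproduce_Re f a : trigpoly Q f -> complex.Re (f (a @g)) =
  lincomb kernel_family (kernel_coef (fun b => complex.Re (f (b @g)))
                                     (fun b => - complex.Im (f (b @g)))) a.
Proof.
move=> Qf; rewrite lincomb_kernel; apply: (mulfI (lt0r_neq0 g0)).
rewrite mulrA mulfV ?lt0r_neq0// mul1r.
have := sum_grid_dirichlet (M := M) BM QB (a @g) Qf.
move=> /(congr1 (@complex.Re R)); rewrite Re_sum.
rewrite (_ : #|{: G}|%:R = (#|{: G}|%:R : R)%:C%C); last by rewrite rmorph_nat.
rewrite Re_mulc/= mul0r subr0 => <-; apply: eq_bigr => b _.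
by rewrite Re_mulc mulNr.
Qed.

Lemma reproduce_Im f a : trigpoly Q f -> complex.Im (f (a @g)) =
  lincomb kernel_family (kernel_coef (fun b => complex.Im (f (b @g)))
                                     (fun b => complex.Re (f (b @g)))) a.
Proof.
move=> Qf; rewrite lincomb_kernel; apply: (mulfI (lt0r_neq0 g0)).
rewrite mulrA mulfV ?lt0r_neq0// mul1r.
have := sum_grid_dirichlet (M := M) BM QB (a @g) Qf.
move=> /(congr1 (@complex.Im R)); rewrite Im_sum.
rewrite (_ : #|{: G}|%:R = (#|{: G}|%:R : R)%:C%C); last by rewrite rmorph_nat.
rewrite Im_mulc/= mul0r addr0 => <-; apply: eq_bigr => b _.
by rewrite Im_mulc addrC.
Qed.

Lemma norm_kernel_family_le i a : `|kernel_family i a| <= #|` Q|%:R.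
Proof.
case: i => [[b|b]|_] /=; last by rewrite normr1.
- exact: le_trans (normRe_le_cabs _) (cabs_dirichlet_le _ _ _).
- exact: le_trans (normIm_le_cabs _) (cabs_dirichlet_le _ _ _).
Qed.

Lemma sum_sqr_kernel_family_le i :
  \sum_a kernel_family i a ^+ 2 <= #|{: G}|%:R * #|` Q|%:R.
Proof.
case: i => [[b|b]|_] /=; last first.
- under eq_bigr do rewrite expr1n.
  by rewrite sumr_const ler_peMr// ltW.
- rewrite -(sum_grid_sqr_dirichlet BM QB (b @g)); apply: ler_sum => a _.
  by rewrite cabsE lerDr sqr_ge0.
- rewrite -(sum_grid_sqr_dirichlet BM QB (b @g)); apply: ler_sum => a _.
  by rewrite cabsE lerDl sqr_ge0.
Qed.

(** The hull estimate is used three times: for the constant generator, which fixes [w * #|S|] up to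
    [1/4], and for the real and imaginary parts of [f]. The hypothesis on [L] counts [2 * #|G| + 1]
    generators. *)
Lemma grid_sampling (L : R) : 0 < L -> 2 * (2 * #|{: G}|%:R + 1) <= expR L ->
  exists S : {set G}, [/\ (0 < #|S|)%N,
    #|S|%:R <= 5 / 4 * (2 * 120 ^+ 2 * (L * #|` Q|%:R)) &
    forall f, trigpoly Q f ->
      5^-1 * grid_mean M (fun x => cabs (f x)) <=
      #|S|%:R^-1 * \sum_(a in S) cabs (f (a @g)) <=
      4 * grid_mean M (fun x => cabs (f x))].
Proof.
move=> L0 GL; have N0 := lt_le_trans ltr01 N1.
have I0 : (0 < #|{: G + G + 'I_1}|)%N by rewrite !card_sum card_ord addn1.
have IL : 2 * #|{: G + G + 'I_1}|%:R <= expR L.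
  by rewrite !card_sum card_ord addnn -mul2n natrD natrM.
have [S [w [w0 wL wS]]] := hull_sampling I0 N0 L0 IL norm_kernel_family_le G0
  sum_sqr_kernel_family_le.
have : `|w * #|S|%:R - 1| <= 4^-1.
  pose c (i : G + G + 'I_1) : R := if i is inr _ then 1 else 0.
  have l1 a : `|lincomb kernel_family c a| = 1.
    rewrite /lincomb !big_sumType/= big_ord1 mul1r !big1 ?addr0 ?add0r ?normr1//.
      by move=> i _; rewrite mul0r.
    by move=> i _; rewrite mul0r.
  have := wS c; under eq_bigr do rewrite l1; rewrite sumr_const.
  under [in X in _ - _ * X]eq_bigr do rewrite l1; rewrite sumr_const mulVf ?lt0r_neq0//.
  move=> /le_trans; apply; rewrite ler_piMr ?invr_ge0// !big_sumType/= big_ord1.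
  by rewrite !big1 ?addr0 ?add0r ?normr1// => i _; rewrite normr0.
rewrite ler_norml => /andP[wS1 wS2].
have S0 : 0 < #|S|%:R :> R by rewrite -(pmulr_rgt0 _ w0); lra.
exists S; split; first by rewrite -(ltr0n R).
  have h : #|S|%:R <= 5 / 4 * w^-1.
    by rewrite ler_pdivlMr// mulrC; lra.
  apply: le_trans h _; rewrite ler_pM2l//.
move=> f Qf; set F := grid_mean _ _.
(* The coefficient mass of both the real and the imaginary part. *)
pose Psi := #|{: G}|%:R^-1 * \sum_(a : G)
  (`|complex.Re (f (a @g))| + `|complex.Im (f (a @g))|).
have PF : F <= Psi <= 2 * F.
  rewrite /F /Psi /grid_mean mulrCA !ler_pM2l ?invr_gt0// mulr_sumr.
  by apply/andP; split; apply: ler_sum => a _; rewrite ?cabs_le_normD ?normD_le_cabs.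
have F0 : 0 <= F by rewrite mulr_ge0 ?invr_ge0// sumr_ge0// => a _; exact: cabs_ge0.
have hRe := wS (kernel_coef (fun b => complex.Re (f (b @g)))
                                     (fun b => - complex.Im (f (b @g)))).
have hIm := wS (kernel_coef (fun b => complex.Im (f (b @g)))
                                     (fun b => complex.Re (f (b @g)))).
move: hRe; rewrite sum_norm_kernel_coef; under [in X in _ <= X]eq_bigr do rewrite normrN.
rewrite -/Psi; under eq_bigr do rewrite -reproduce_Re//.
under [in X in _ - _ * X]eq_bigr do rewrite -reproduce_Re//.
move=> hRe; move: hIm; rewrite sum_norm_kernel_coef.
under [in X in _ <= X]eq_bigr do rewrite addrC.
rewrite -/Psi; under eq_bigr do rewrite -reproduce_Im//.
under [in X in _ - _ * X]eq_bigr do rewrite -reproduce_Im//.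
move=> hIm; move: hRe hIm; rewrite !ler_norml => /andP[r1 r2] /andP[i1 i2].
have PsiE : Psi = #|{: G}|%:R^-1 * (\sum_(a : G) `|complex.Re (f (a @g))|) +
   #|{: G}|%:R^-1 * (\sum_(a : G) `|complex.Im (f (a @g))|).
  by rewrite /Psi big_split/= mulrDr.
have h1 : \sum_(a in S) cabs (f (a @g)) <=
    \sum_(a in S) `|complex.Re (f (a @g))| + \sum_(a in S) `|complex.Im (f (a @g))|.
  by rewrite -big_split/=; apply: ler_sum => a _; exact: cabs_le_normD.
have h2 : \sum_(a in S) `|complex.Re (f (a @g))| +
    \sum_(a in S) `|complex.Im (f (a @g))| <= 2 * \sum_(a in S) cabs (f (a @g)).
  by rewrite -big_split/= mulr_sumr; apply: ler_sum => a _; exact: normD_le_cabs.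
move/andP: PF => [PF1 PF2]; move: h1; rewrite -(ler_pM2l w0) => h1.
move: h2; rewrite -(ler_pM2l w0) => h2.
(* The two errors total at most [Psi / 2], so the weighted sum of [|Re f| + |Im f|] over [S] lies
   between [Psi / 2] and [3 / 2 * Psi]. With [w * #|S|] between [3/4] and [5/4], this gives [1/5]
   and [4]. *)
apply/andP; split.
  rewrite ler_pdivlMl// -(ler_pM2l w0).
  have : w * #|S|%:R * F <= 5 / 4 * F by rewrite ler_wpM2r//; lra.
  by nra.
rewrite ler_pdivrMl// -(ler_pM2l w0).
have : 3 / 4 * F <= w * #|S|%:R * F by rewrite ler_wpM2r//; lra.
by nra.
Qed.

End grid_sampling.

(** * Comparison of the discrete and continuous norms *)

Section lipschitz.
Context {R : realType}.

Lemma dist_le_of_derive_bound (f df : R -> R) (K : R) :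
  (forall x : R, is_derive x (1 : R) f (df x)) -> (forall x : R, `|df x| <= K) ->
  forall x y : R, `|f x - f y| <= K * `|x - y|.
Proof.
move=> fd dfK x y; wlog xy : x y / y <= x => [th|].
  have [|/ltW] := leP y x; first exact: th.
  by move=> /th; rewrite distrC [X in _ * X]distrC.
have fc : {within `[y, x], continuous f}.
  apply: derivable_within_continuous => z _.
  by have [] := fd z.
have [c _ ->] := @MVT_segment _ f df y x xy (fun z _ => fd z) fc.
by rewrite normrM ler_wpM2r.
Qed.

Lemma cabs_expiB_le (s t : R) : cabs (expi s - expi t) <= 2 * `|s - t|.
Proof.
apply: le_trans (cabs_le_normD _) _ => /=.
rewrite -[2]/(1 + 1) mulrDl; apply: lerD.
  apply: (dist_le_of_derive_bound (fun x => is_derive_cos x)) => x.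
  by rewrite normrN sin_max.
exact: (dist_le_of_derive_bound (fun x => is_derive_sin x) (@cos_max R)).
Qed.

Lemma dist_cabs_le (z1 z2 : R[i]) : `|cabs z1 - cabs z2| <= cabs (z1 - z2).
Proof.
have h (a b : R[i]) : cabs a <= cabs (a - b) + cabs b.
  by have := cabsD (a - b) b; rewrite subrK.
have hN (a : R[i]) : cabs (- a) = cabs a.
  by case: a => a b; rewrite /cabs/= !sqrrN.
have := h z1 z2; have := h z2 z1; rewrite -opprB hN.
by rewrite ler_norml; lra.
Qed.

Lemma dist_dotp_le d (k : d.-tuple int) (x y : d.-tuple R) (B : nat) (h : R) :
  (forall i, `|tnth k i| <= B%:Z) ->
  (forall i, `|tnth x i - tnth y i| <= h) ->
  `|dotp k x - dotp k y| <= d%:R * (B%:R * h).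
Proof.
move=> kB xy; rewrite /dotp -sumrB; apply: le_trans (ler_norm_sum _ _ _) _.
rewrite -[X in X%:R * _](card_ord d) -sum1_card natr_sum mulr_suml.
apply: ler_sum => i _; rewrite mul1r -mulrBr normrM ler_pM//.
by rewrite -intr_norm -[leRHS]/(B%:Z%:~R) ler_int.
Qed.

End lipschitz.

(** * Riemann sums for the integral over the torus *)

Section boxes.
Context {R : realType}.

Definition box d (A : 'I_d -> set R) : set (d.-tuple R) :=
  [set x | forall i, A i (tnth x i)].

Lemma measurable_box d (A : 'I_d -> set R) :
  (forall i, measurable (A i)) -> measurable (box A).
Proof.
move=> mA; have -> : box A = \bigcap_(i in [set: 'I_d]) ((fun x => tnth x i) @^-1` A i).
  by apply/seteqP; split=> x h i; [move=> _; exact: h|exact: (h i I)].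
apply: fin_bigcap_measurable => // i _; rewrite -[X in measurable X]setTI.
exact: measurable_tnth.
Qed.

Lemma lebesgue_tuple_box d (A : 'I_d -> set R) (h : R) :
  (forall i, measurable (A i)) ->
  (forall i, lebesgue_measure (A i) = h%:E) ->
  lebesgue_tuple R d (box A) = (h ^+ d)%:E.
Proof.
elim: d A => [|d IH] A mA hA.
  rewrite /= diracE mem_set ?expr0// => i.
  by have := ltn_ord i; rewrite ltn0.
rewrite /= /lebesgue_tupleS /pushforward.
have -> : @consT R d @^-1` box A = A ord0 `*` box (fun i => A (lift ord0 i)).
  apply/seteqP; split=> -[x t] /=.
    move=> h'; split; first by have := h' ord0; rewrite tnth0.
    by move=> i; have := h' (lift ord0 i); rewrite tnthS.
  move=> [/= Ax At] i; have [j ->|->] := unliftP ord0 i; last exact: Ax.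
  by rewrite tnthS.
rewrite product_measure1E; [|exact: mA|exact: measurable_box].
by rewrite IH// exprS EFinM; congr (_ * _)%E; exact: hA.
Qed.

(** The integral is delivered as a real number so that the cells can be summed in [R]. *)
Lemma integral_near_cst d (T : measurableType d) (mu : {measure set T -> \bar R})
  (D : set T) (g : T -> R) (c e v : R) : measurable D -> measurable_fun D g ->
  (forall x, D x -> 0 <= g x) -> mu D = v%:E -> 0 <= c -> 0 <= e ->
  (forall x, D x -> `|g x - c| <= e) ->
  exists j, (\int[mu]_(x in D) (g x)%:E)%E = j%:E /\
    (c - e) * v <= j <= (c + e) * v.
Proof.
move=> mD mg g0 muD c0 e0 gc.
have mgE : measurable_fun D (EFin \o g) by exact/measurable_EFinP.
have J0 : (0 <= \int[mu]_(x in D) (g x)%:E)%E.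
  by apply: integral_ge0 => x Dx; rewrite lee_fin g0.
have J1 : (\int[mu]_(x in D) (g x)%:E <= ((c + e) * v)%:E)%E.
  rewrite EFinM -muD -integral_cst//; apply: ge0_le_integral => //.
  by move=> x Dx; rewrite lee_fin; have := gc _ Dx; rewrite ler_norml; lra.
(* The error is added to the integral rather than subtracted from [c], which keeps all integrands
   nonnegative. *)
have J2 : ((c * v)%:E <= \int[mu]_(x in D) (g x)%:E + (e * v)%:E)%E.
  rewrite !EFinM -muD -!integral_cst// -ge0_integralD//.
  apply: ge0_le_integral => //; first exact: emeasurable_funD.
  by move=> x Dx; rewrite /= -EFinD lee_fin; have := gc _ Dx; rewrite ler_norml; lra.
move: J0 J1 J2; case: (integral _ _ _) => [j| |]//=.
rewrite -EFinD !lee_fin => _ j1 j2; exists j; split => //.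
by rewrite j1 andbT mulrBl lerBlDr.
Qed.

End boxes.

Section riemann_sum.
Context {R : realType} (d M : nat) (M0 : (0 < M)%N).
Local Notation G := {ffun 'I_d -> 'I_M}.

Definition cell_side (a : nat) : set R :=
  `[2 * pi * a%:R / M%:R, 2 * pi * a.+1%:R / M%:R[%classic.

Definition cell (a : G) : set (d.-tuple R) := box (fun i => cell_side (a i)).

Let Mr : 0 < M%:R :> R. Proof. by rewrite ltr0n. Qed.

Let h0 : 0 < 2 * pi / M%:R :> R.
Proof. by rewrite divr_gt0// mulr_gt0// pi_gt0. Qed.

Lemma measurable_cell a : measurable (cell a).
Proof. by apply: measurable_box => i; exact: measurable_itv. Qed.

Lemma lebesgue_tuple_cell a :
  lebesgue_tuple R d (cell a) = ((2 * pi / M%:R) ^+ d)%:E.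
Proof.
apply: lebesgue_tuple_box => i; first exact: measurable_itv.
rewrite /cell_side lebesgue_measure_itv/= lte_fin.
rewrite ltr_pM2r ?invr_gt0// ltr_pM2l ?mulr_gt0 ?pi_gt0// ltr_nat ltnSn.
rewrite -EFinD; congr EFin; rewrite -[(a i).+1%:R]natr1; field.
by rewrite lt0r_neq0.
Qed.

Lemma cell_dist a x : cell a x -> forall i,
  `|tnth x i - tnth (grid_point a) i| <= 2 * pi / M%:R.
Proof.
move=> ax i; have := ax i; rewrite /cell_side/= in_itv/= tnth_mktuple => /andP[x1 x2].
rewrite ger0_norm ?subr_ge0// lerBlDr ltW// (lt_le_trans x2)//.
by rewrite -[(a i).+1%:R]natr1 mulrDr mulr1 mulrDl addrC.
Qed.

(** Indexing the half-open sides by truncation yields both that the cells cover the torus and that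
    they are disjoint. *)
Lemma cell_sideP (x : R) (a : nat) : 0 <= x ->
  cell_side a x <-> Num.truncn (x / (2 * pi / M%:R)) = a.
Proof.
move=> x0; have y0 : 0 <= x / (2 * pi / M%:R) by rewrite divr_ge0// ltW.
have e (b : nat) : 2 * pi * b%:R / M%:R = b%:R * (2 * pi / M%:R) by ring.
rewrite /cell_side/= in_itv/= !e -ler_pdivlMr// -ltr_pdivrMr//.
split=> [|<-].
  by move=> /truncn_def.
exact: truncn_itv.
Qed.

Lemma torus_cells : torus R d = \big[setU/set0]_(a : G) cell a.
Proof.
rewrite -bigcup_pred; apply/seteqP; split=> [x tx|x [a _ xa] i].
  have lt_trunc i : (Num.truncn (tnth x i / (2 * pi / M%:R)) < M)%N.
    have /andP[x0 x1] := tx i.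
    rewrite truncn_lt_nat; last by rewrite divr_ge0// ltW.
    rewrite ltr_pdivrMr//.
    by rewrite mulrCA mulfV ?mulr1// lt0r_neq0.
  exists [ffun i => Ordinal (lt_trunc i)] => // i.
  by rewrite ffunE; apply/cell_sideP => //; have /andP[] := tx i.
have := xa i; rewrite /cell_side/= in_itv/= => /andP[x1 x2].
apply/andP; split; first by rewrite (le_trans _ x1)// !mulr_ge0 ?invr_ge0 ?pi_ge0.
rewrite (lt_le_trans x2)// ler_pdivrMr// ler_pM2l ?mulr_gt0 ?pi_gt0//.
by rewrite ler_nat.
Qed.

Lemma cell_torus a : cell a `<=` torus R d.
Proof. by move=> x ax; rewrite torus_cells -bigcup_pred; exists a. Qed.

Lemma trivIset_cell (s : seq G) : trivIset [set` s] cell.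
Proof.
apply/trivIsetP => a b _ _; apply: contra_neqP => /eqP/set0P[x [ax bx]].
apply/ffunP => i; apply/val_inj => /=.
have x0 : 0 <= tnth x i by have /andP[] := cell_torus ax i.
have /(cell_sideP _ x0) <- := ax i; have /(cell_sideP _ x0) <- := bx i.
by [].
Qed.

(** Each cell has normalized measure [#|G|^-1], so moving to the corners of the cells costs an
    average of errors at most [e]. *)
Lemma norm1_riemann_sum (f : d.-tuple R -> R[i]) (e : R) : 0 <= e ->
  measurable_fun [set: d.-tuple R] (fun x => cabs (f x)) ->
  (forall a x, cell a x -> `|cabs (f x) - cabs (f (grid_point a))| <= e) ->
  `|norm1 f - grid_mean M (fun x => cabs (f x))| <= e.
Proof.
rewrite /grid_mean => e0 mf fe; set v := (2 * pi / M%:R) ^+ d : R.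
have v0 : 0 < v by rewrite exprn_gt0.
have /choice[j jP] : forall a : G, exists j,
    (\int[lebesgue_tuple R d]_(x in cell a) (cabs (f x))%:E)%E = j%:E /\
    (cabs (f (grid_point a)) - e) * v <= j <= (cabs (f (grid_point a)) + e) * v.
  move=> a; apply: integral_near_cst => //.
  - exact: measurable_cell.
  - exact: measurable_funTS.
  - by move=> x _; exact: cabs_ge0.
  - exact: lebesgue_tuple_cell.
  - exact: cabs_ge0.
  - exact: fe.
have -> : norm1 f = (2 * pi) ^- d * \sum_(a : G) j a.
  rewrite /norm1 /Rintegral torus_cells ge0_integral_bigsetU//.
  - by under eq_bigr do rewrite (jP _).1; rewrite sumEFin.
  - exact: measurable_cell.
  - exact: index_enum_uniq.
  - exact: trivIset_cell.
  - by apply/measurable_EFinP; exact: measurable_funTS.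
  - by move=> x _; rewrite lee_fin cabs_ge0.
have Gv : #|{: G}|%:R^-1 = (2 * pi) ^- d * v.
  rewrite card_ffun !card_ord natrX /v expr_div_n mulKf//.
  by rewrite lt0r_neq0// exprn_gt0// mulr_gt0// pi_gt0.
have Gs : #|{: G}|%:R^-1 * \sum_(a : G) e = e.
  rewrite sumr_const -[e *+ _]mulr_natl mulKf//.
  by rewrite pnatr_eq0 card_ffun !card_ord -lt0n expn_gt0 M0.
have p0 : 0 < (2 * pi) ^- d :> R by rewrite invr_gt0 exprn_gt0// mulr_gt0// pi_gt0.
rewrite -[leRHS]Gs Gv -!mulrA -mulrBr normrM gtr0_norm// ler_pM2l//.
rewrite !mulr_sumr -sumrB; apply: le_trans (ler_norm_sum _ _ _) _.
apply: ler_sum => a _; have [_] := jP a.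
by rewrite ler_norml !mulrDl mulNr !(mulrC v); lra.
Qed.

End riemann_sum.

Section trigpoly_norm.
Context {R : realType}.

Lemma measurable_cabs_trigpoly d (Q : {fset d.-tuple int})
    (f : d.-tuple R -> R[i]) : trigpoly Q f ->
  measurable_fun [set: d.-tuple R] (fun x => cabs (f x)).
Proof.
case=> c ->.
have mdot k : measurable_fun [set: d.-tuple R] (dotp k).
  apply: measurable_sum => i; apply: measurable_funM => //.
  exact: measurable_tnth.
have mcos k : measurable_fun [set: d.-tuple R] (fun x => cos (dotp k x)).
  apply: (measurableT_comp _ (mdot k)); apply: continuous_measurable_fun.
  exact: continuous_cos.
have msin k : measurable_fun [set: d.-tuple R] (fun x => sin (dotp k x)).
  apply: (measurableT_comp _ (mdot k)); apply: continuous_measurable_fun.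
  exact: continuous_sin.
pose u x := \sum_(k <- Q) (complex.Re (c k) * cos (dotp k x) -
                           complex.Im (c k) * sin (dotp k x)).
pose v x := \sum_(k <- Q) (complex.Re (c k) * sin (dotp k x) +
                           complex.Im (c k) * cos (dotp k x)).
have -> : (fun x => cabs (\sum_(k <- Q) c k * expi (dotp k x))) =
    (fun x => Num.sqrt (u x ^+ 2 + v x ^+ 2)).
  apply/funext => x; rewrite -[LHS]ger0_norm ?cabs_ge0// -sqrtr_sqr cabsE.
  rewrite Re_sum Im_sum; congr (Num.sqrt (_ ^+ 2 + _ ^+ 2)).
    by apply: eq_bigr => k _; rewrite Re_mulc.
  by apply: eq_bigr => k _; rewrite Im_mulc.
apply: measurableT_comp; first by apply: continuous_measurable_fun; exact: sqrt_continuous.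
apply: measurable_funD; apply: measurable_funX; apply: measurable_sum => k.
  by apply: measurable_funB; exact: measurable_funM.
by apply: measurable_funD; exact: measurable_funM.
Qed.

(** The coefficients are at most the grid mean [F], so within a cell [f] moves by at most
    [F * #|Q| * 4 * pi * d * B / M]. With [pi <= 4], the constant 32 brings this below [F / 2]. *)
Lemma norm1_grid (d M B : nat) (Q : {fset d.-tuple int})
    (f : d.-tuple R -> R[i]) :
  (4 * B < M)%N -> (32 * #|` Q| * d * B <= M)%N ->
  (forall k, k \in Q -> forall i, `|tnth k i| <= B%:Z) -> trigpoly Q f ->
  `|norm1 f - grid_mean M (fun x => cabs (f x))| <=
    grid_mean M (fun x => cabs (f x)) / 2.
Proof.
move=> BM NM QB Qf; set F := grid_mean _ _; have M0 : (0 < M)%N := leq_ltn_trans (leq0n _) BM.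
have Mr : 0 < M%:R :> R by rewrite ltr0n.
have g0 : 0 < #|{: {ffun 'I_d -> 'I_M}}|%:R :> R.
  by rewrite ltr0n card_ffun !card_ord expn_gt0 M0.
have F0 : 0 <= F by rewrite mulr_ge0 ?invr_ge0// sumr_ge0// => a _; exact: cabs_ge0.
apply: norm1_riemann_sum => //; first by rewrite divr_ge0.
  exact: measurable_cabs_trigpoly Qf.
move=> a x ax; apply: le_trans (dist_cabs_le _ _) _.
have [c fE] := Qf.
have cF k : k \in Q -> cabs (c k) <= F.
  move=> kQ; rewrite /F /grid_mean ler_pdivlMl// fE.
  exact: (cabs_coef_le BM QB).
have -> : f x - f (grid_point a) =
    \sum_(k <- Q) c k * (expi (dotp k x) - expi (dotp k (grid_point a))).
  by rewrite fE -sumrB; apply: eq_bigr => k _; rewrite mulrBr.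
apply: le_trans (cabs_sum _ _ _) _.
pose q : R := F * (2 * (d%:R * (B%:R * (2 * pi / M%:R)))).
apply: (@le_trans _ _ (\sum_(k <- Q) q)).
  rewrite big_seq [leRHS]big_seq; apply: ler_sum => k kQ.
  rewrite cabsM ler_pM ?cabs_ge0 ?cF//.
  apply: le_trans (cabs_expiB_le _ _) _; rewrite ler_pM2l//.
  apply: dist_dotp_le; first exact: QB.
  exact: cell_dist.
rewrite big_const_seq count_predT iter_addr_0 -[leLHS]mulr_natr.
rewrite /q -mulrA ler_wpM2l// -[_ * _ * _]mulrA.
have -> : 2 * (d%:R * (B%:R * (2 * pi / M%:R)) * #|` Q|%:R) =
   (4 * #|` Q|%:R * d%:R * B%:R * pi) / M%:R :> R by ring.
rewrite ler_pdivrMr//.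
have pi4 : pi <= 4 :> R by have := pihalf_lt2 R; lra.
have : 4 * #|` Q|%:R * d%:R * B%:R * pi <= 4 * #|` Q|%:R * d%:R * B%:R * 4 :> R.
  by rewrite ler_wpM2l// !mulr_ge0.
have : (32 * #|` Q| * d * B)%:R <= M%:R :> R by rewrite ler_nat.
by rewrite !natrM; lra.
Qed.

End trigpoly_norm.

(** * Size of the grid and conclusion *)

(** Shifting each coordinate by [B] embeds [Q] in a finite box. Thanks to this bound the grid size
    can depend on [n] and [d] only. *)
Lemma card_bounded_freqs (d B : nat) (Q : {fset d.-tuple int}) :
  (forall k, k \in Q -> forall i, `|tnth k i| <= B%:Z) ->
  (#|` Q| <= (2 * B).+1 ^ d)%N.
Proof.
move=> QB.
pose phi (k : d.-tuple int) : {ffun 'I_d -> 'I_(2 * B).+1} :=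
  [ffun i => inord (absz (tnth k i + B%:Z))].
have phi_inj : {in Q &, injective phi}.
  move=> k l kQ lQ kl; apply: eq_from_tnth => i.
  have := congr1 (fun t : {ffun 'I_d -> 'I_(2 * B).+1} => (t i : nat)) kl; rewrite /= !ffunE.
  have := QB _ kQ i; have := QB _ lQ i; rewrite !ler_norml.
  move: (tnth k i) (tnth l i) => x y /andP[y1 y2] /andP[x1 x2].
  by rewrite !inordK; lia.
have -> : #|` Q| = size (map phi Q) by rewrite size_map.
rewrite -[X in (_ <= X ^ _)%N]card_ord -[X in (_ <= _ ^ X)%N]card_ord.
rewrite -card_ffun; have /card_uniqP <- : uniq (map phi Q).
  by rewrite map_inj_in_uniq// fset_uniq.
exact: max_card.
Qed.

(** As [2 * 2 ^ n + 1 <= 2 ^ (n + 2)], [32 = 2 ^ 5] and [d <= 2 ^ d], the exponents sum to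
    [5 + (n + 2) * d + d + n], at most [10 * n * d]. *)
Lemma leq_poly_expn n d N : (0 < n)%N -> (0 < d)%N ->
  (N <= (2 * 2 ^ n).+1 ^ d)%N -> (32 * N * d * 2 ^ n <= 2 ^ (10 * n * d))%N.
Proof.
move=> n0 d0 Nle.
have N2 : (N <= 2 ^ ((n + 2) * d))%N.
  apply: leq_trans Nle _; rewrite expnM leq_exp2r// expnD.
  by have := expn_gt0 2 n; lia.
apply: (@leq_trans (2 ^ 5 * 2 ^ ((n + 2) * d) * 2 ^ d * 2 ^ n)).
  by rewrite !leq_mul// ltnW// ltn_expl.
have nd : (n <= n * d)%N by rewrite leq_pmulr.
have dn : (d <= n * d)%N by rewrite leq_pmull.
by rewrite -!expnD leq_exp2l// -mulnA; lia.
Qed.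

Theorem theorem3p1 (R : realType) :
  exists C2 C3 : R, [/\ 0 < C2, 0 < C3 &
    forall d : nat, (0 < d)%N ->
    exists2 C1 : R, 0 < C1 &
    forall (n : nat) (Q : {fset d.-tuple int}),
      (0 < n)%N -> Q != fset0 ->
      (forall k, k \in Q -> forall i, - 2 ^+ n <= tnth k i <= 2 ^+ n) ->
    exists (m : nat) (xi : 'I_m -> d.-tuple R),
      [/\ (0 < m)%N,
          m%:R <= C1 * #|` Q|%:R * n%:R `^ (7 / 2),
          injective xi,
          (forall j, torus R d (xi j)) &
          forall f, trigpoly Q f ->
            C2 * norm1 f <= m%:R^-1 * \sum_(j < m) cabs (f (xi j))
              <= C3 * norm1 f]].
Proof.
(* [norm1_grid] puts [norm1 f] between [F / 2] and [3 / 2 * F] for the grid mean [F]; combined with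
   the factors [1/5] and [4] of [grid_sampling], this gives [2/15] and [8]. *)
exists (2 / 15), 8; split=> // d d0.
exists (5 / 4 * (2 * 120 ^+ 2 * (13 * d%:R ^+ 2))).
  by rewrite !mulr_gt0 ?exprn_gt0 ?ltr0n.
move=> n Q n0 Q0 Qn.
have QB k : k \in Q -> forall i, `|tnth k i| <= (2 ^ n)%N%:Z.
  by move=> kQ i; have := Qn k kQ i; rewrite ler_norml -[Posz _]natz natrX.
pose M := (2 ^ (10 * n * d))%N.
have NM : (32 * #|` Q| * d * 2 ^ n <= M)%N.
  exact: leq_poly_expn n0 d0 (card_bounded_freqs QB).
have BM : (4 * 2 ^ n < M)%N.
  have nd : (n <= n * d)%N by rewrite leq_pmulr.
  by rewrite /M (_ : 4%N = (2 ^ 2)%N)// -expnD ltn_exp2l// -mulnA; lia.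
(* The grid has [2 ^ (10 * n * d ^ 2)] points, so the left side of [GL] is at most
   [2 ^ (10 * n * d ^ 2 + 3)]; then [2 <= expR 1]. *)
pose L : R := (13 * n * d ^ 2)%N%:R.
have L0 : 0 < L by rewrite ltr0n !muln_gt0 n0 d0.
have GL : 2 * (2 * #|{: {ffun 'I_d -> 'I_M}}|%:R + 1) <= expR L.
  rewrite card_ffun !card_ord /M -expnM -[L]mulr1 expRM_natl.
  apply: (@le_trans _ _ (2 ^+ (13 * n * d ^ 2))); last first.
    by rewrite lerXn2r ?nnegrE ?expR_ge0// (le_trans _ (expR_ge1Dx _)).
  rewrite -natrX -natrM natr1 -natrM ler_nat.
  apply: (@leq_trans (2 ^ (10 * n * d * d + 3))).
    by rewrite expnD; have := expn_gt0 2 (10 * n * d * d); lia.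
  by rewrite leq_exp2l//; nia.
have [S [S0 SL Sf]] := grid_sampling BM Q0 QB L0 GL.
exists #|S|, (fun j => grid_point (enum_val j)); split => //.
- apply: le_trans SL _.
  (* The number of points obtained is linear in [n], and [1 <= n]. *)
  have n1 : n%:R <= n%:R `^ (7 / 2) :> R.
    by rewrite -[leLHS]powRr1// ler_powR ?ler1n//; lra.
  have -> : L = 13 * n%:R * d%:R ^+ 2 by rewrite /L natrM natrX natrM.
  set C := 5 / 4 * (2 * 120 ^+ 2 * (13 * d%:R ^+ 2)).
  rewrite (_ : 5 / 4 * _ = C * #|` Q|%:R * n%:R); last by rewrite /C; ring.
  by rewrite ler_wpM2l// !mulr_ge0// exprn_ge0.
- by move=> i j /grid_point_inj /enum_val_inj.
- by move=> j; exact: grid_point_torus.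
- move=> f Qf; have := norm1_grid BM NM QB Qf; rewrite ler_norml => /andP[n1 n2].
  have /andP[s1 s2] := Sf f Qf.
  have -> : \sum_(j < #|S|) cabs (f (grid_point (enum_val j))) =
      \sum_(a in S) cabs (f (grid_point a)).
    by rewrite [RHS]big_enum_val.
  by apply/andP; split; lra.
Qed.
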